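(* For every integer $n\ge 3$, the monoid $G^+_n=\langle a,b,c \mid cb^n=b^na,\ ab=bc,\ ac=ca\rangle_{mo}$ is cancellative.
   Context: $\langle L\mid R\rangle_{mo}$ denotes the monoid presented by generators $L$ and relations $R$, i.e. the quotient of the free monoid $L^*$ by the congruence generated by $R$. A monoid $M$ is cancellative if $AXB=AYB$ with $A,B,X,Y\in M$ implies $X=Y$. *)

(* Defs.v *)
From HB Require Import structures.
From mathcomp Require Import all_boot.
#[warnings="-notation-overridden"]
From mathcomp Require Import boolp classical_sets.

Set Implicit Arguments.
Unset Strict Implicit.
Unset Printing Implicit Defensive.

Local Open Scope classical_set_scope.
Local Open Scope quotient_scope.

(* The free monoid on L is seq L: the product is ++ and the unit is [::]. *)

Section Congruence.
Variables (L : choiceType) (R : set (seq L * seq L)).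

Inductive gen_cong : seq L -> seq L -> Prop :=
| gen_cong_base u v : R (u, v) -> gen_cong u v
| gen_cong_refl u : gen_cong u u
| gen_cong_sym u v : gen_cong u v -> gen_cong v u
| gen_cong_trans u v w : gen_cong u v -> gen_cong v w -> gen_cong u w
| gen_cong_cat u u' v v' :
    gen_cong u u' -> gen_cong v v' -> gen_cong (u ++ v) (u' ++ v').

(* {eq_quot _} expects a boolean relation, hence the classical reflection. *)
Definition gen_congb : rel (seq L) := fun u v => `[< gen_cong u v >].

Lemma gen_congb_refl : reflexive gen_congb.
Proof. by move=> u; apply/asboolP/gen_cong_refl. Qed.

Lemma gen_congb_sym : symmetric gen_congb.
Proof. by move=> u v; apply/asboolP/asboolP; apply: gen_cong_sym. Qed.

Lemma gen_congb_trans : transitive gen_congb.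
Proof.
by move=> v u w /asboolP uv /asboolP vw; apply/asboolP/(gen_cong_trans uv vw).
Qed.

Canonical gen_congb_equiv :=
  EquivRel gen_congb gen_congb_refl gen_congb_sym gen_congb_trans.

End Congruence.

Definition presented_monoid (L : choiceType) (R : set (seq L * seq L)) :=
  {eq_quot (gen_congb R)}.

Section PresentedMonoid.
Variables (L : choiceType) (R : set (seq L * seq L)).
Local Notation M := (presented_monoid R).

HB.instance Definition _ := Choice.on M.
HB.instance Definition _ := EqQuotient.on M.

Lemma pi_presentedP (u v : seq L) : \pi_M u = \pi_M v <-> gen_cong R u v.
Proof.
split=> [/eqP|uv]; first by rewrite eqmodE => /asboolP.
by apply/eqP; rewrite eqmodE; apply/asboolP.
Qed.

Definition presented_mul (x y : M) : M := \pi_M (repr x ++ repr y).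

Lemma pi_presented_cat (u v : seq L) :
  presented_mul (\pi_M u) (\pi_M v) = \pi_M (u ++ v).
Proof.
by apply/pi_presentedP; apply: gen_cong_cat; apply/pi_presentedP; rewrite reprK.
Qed.

Lemma presented_mulA : associative presented_mul.
Proof.
elim/quotW=> u; elim/quotW=> v; elim/quotW=> w.
by rewrite (pi_presented_cat v w) (pi_presented_cat u v) !pi_presented_cat catA.
Qed.

Lemma presented_mul1x : left_id (\pi_M [::]) presented_mul.
Proof. by elim/quotW=> u; rewrite pi_presented_cat. Qed.

Lemma presented_mulx1 : right_id (\pi_M [::]) presented_mul.
Proof. by elim/quotW=> u; rewrite pi_presented_cat cats0. Qed.

HB.instance Definition _ :=
  isMonoid.Build M presented_mulA presented_mul1x presented_mulx1.

End PresentedMonoid.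

Definition cancellative (M : monoidType) : Prop :=
  forall A B X Y : M, (A * X * B = A * Y * B)%g -> X = Y.

Variant letter := La | Lb | Lc.

Definition ord_of_letter (x : letter) : 'I_3 :=
  match x with La => inord 0 | Lb => inord 1 | Lc => inord 2 end.

Definition letter_of_ord (i : 'I_3) : letter :=
  match val i with 0 => La | 1 => Lb | _ => Lc end.

Lemma ord_of_letterK : cancel ord_of_letter letter_of_ord.
Proof. by case; rewrite /letter_of_ord /= inordK. Qed.

HB.instance Definition _ := Finite.copy letter (can_type ord_of_letterK).

Definition Gplus_rels (n : nat) : set (seq letter * seq letter) :=
  [set (Lc :: nseq n Lb, nseq n Lb ++ [:: La]);
       ([:: La; Lb], [:: Lb; Lc]);
       ([:: La; Lc], [:: Lc; La])].

Definition Gplus (n : nat) : monoidType := presented_monoid (Gplus_rels n).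

(* Main.v *)
Require Import Defs.
From mathcomp Require Import all_boot.
From mathcomp Require Import zify.

(* Give every occurrence of [a] or [c] in a word a type in Z/(n+1): if it is
   preceded by [l] letters [b], an [a] has type [l] and a [c] has type [l - 1].
   The relations [ab = bc] and [cb^n = b^na] preserve types, and [ac = ca]
   commutes letters of consecutive types.  So the monoid maps to the semidirect
   product of N, acting by rotation, with the trace monoid T of the (n+1)-cycle,
   and T is detected by its projections to pairs of non-commuting types; both
   facts together make cancellation obvious in the target.  The map is
   injective: if [u = x u'] with [x <> b] and [v] has the same image, the first
   letter of [v] of the type of [x] is preceded only by letters of adjacent type,
   and can be moved to the front of [v] by means of the relations. *)

Set Implicit Arguments.
Unset Strict Implicit.
Unset Printing Implicit Defensive.

Local Open Scope quotient_scope.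

Section Gplus.
Variable n : nat.

Local Notation "u ~~~ v" := (gen_cong (Gplus_rels n) u v) (at level 70).

(** * Levels, types and the trace invariants of a word *)

Definition cyc_succ l := if l == n then 0 else l.+1.
Definition cyc_pred l := if l == 0 then n else l.-1.

(* Unlike [x == Lb], this computes on constructors. *)
Definition is_b x := if x is Lb then true else false.

Definition letter_type l x := if x is La then l else cyc_pred l.

Fixpoint types l (w : seq letter) : seq nat :=
  match w with
  | [::] => [::]
  | Lb :: w' => types (cyc_succ l) w'
  | x :: w' => letter_type l x :: types l w'
  end.

Definition end_level l (w : seq letter) := iter (count is_b w) cyc_succ l.

Definition adjacent p q := (q == cyc_succ p) || (p == cyc_succ q).

Definition same_trace l u v :=
  count is_b u = count is_b v /\
  forall p q, ~~ adjacent p q ->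
    filter (pred2 p q) (types l u) = filter (pred2 p q) (types l v).

Lemma types_cons l x w : ~~ is_b x -> types l (x :: w) = letter_type l x :: types l w.
Proof. by case: x. Qed.

Lemma end_level_cons l x w :
  end_level l (x :: w) = end_level (if is_b x then cyc_succ l else l) w.
Proof. by rewrite /end_level; case: x => //; exact: iterSr. Qed.

Lemma types_cat l u v : types l (u ++ v) = types l u ++ types (end_level l u) v.
Proof.
by elim: u l => [//|x u IHu] l; rewrite end_level_cons; case: x; rewrite /= IHu.
Qed.

Lemma cyc_succ_le l : l <= n -> cyc_succ l <= n.
Proof. by rewrite /cyc_succ; case: eqP; lia. Qed.

Lemma cyc_predK l : l <= n -> cyc_succ (cyc_pred l) = l.
Proof. by rewrite /cyc_succ /cyc_pred; do !case: eqP; lia. Qed.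

Lemma end_level_le l w : l <= n -> end_level l w <= n.
Proof.
rewrite /end_level; elim: (count _ _) => //= k IHk /IHk.
exact: cyc_succ_le.
Qed.

Lemma letter_type_le l x : l <= n -> letter_type l x <= n.
Proof. by rewrite /letter_type /cyc_pred; case: x => //; case: eqP; lia. Qed.

Lemma iter_cyc_succ l k : l <= n -> k <= n ->
  iter k cyc_succ l = if l + k <= n then l + k else l + k - n.+1.
Proof.
move=> ln; elim: k => [|k IHk] kn; first by rewrite addn0 ln.
rewrite iterS (IHk (ltnW kn)) /cyc_succ.
by case: (leqP (l + k) n) => ?; do !case: ifP; lia.
Qed.

Lemma iter_cyc_succ_pred l : l <= n -> iter n cyc_succ l = cyc_pred l.
Proof. by move=> ln; rewrite iter_cyc_succ // /cyc_pred; do ?case: ifP; lia. Qed.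

Lemma same_traceC l u v : same_trace l u v -> same_trace l v u.
Proof. by case=> C P; split=> // p q pq; rewrite P. Qed.

Lemma same_trace_trans l u v w :
  same_trace l u v -> same_trace l v w -> same_trace l u w.
Proof. by case=> C P [D Q]; split=> [|p q pq]; rewrite ?C // P ?Q. Qed.

Lemma same_trace_cat l u u' v v' : l <= n ->
    same_trace l u u' -> (forall k, k <= n -> same_trace k v v') ->
  same_trace l (u ++ v) (u' ++ v').
Proof.
move=> ln [Cu Pu] /(_ (end_level l u) (end_level_le u ln)) [Cv Pv].
split=> [|p q pq]; first by rewrite !count_cat Cu Cv.
by rewrite !types_cat !filter_cat Pu // Pv // /end_level Cu.
Qed.

Lemma types_nseqb l k w : types l (nseq k Lb ++ w) = types (iter k cyc_succ l) w.
Proof. by elim: k l => [//|k IHk] l; rewrite /= IHk -iterSr. Qed.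

Lemma gen_cong_size u v : u ~~~ v -> size u = size v.
Proof.
elim=> {u v} [u v|u|u v _ ->|u v w _ -> _ ->|u u' v v' _ Eu _ Ev] //.
  by case=> [[]|] [-> ->] //=; rewrite size_cat size_nseq /= addn1.
by rewrite !size_cat Eu Ev.
Qed.

Lemma gen_cong_same_trace u v : u ~~~ v -> forall l, l <= n -> same_trace l u v.
Proof.
elim=> {u v} [u v uv|u|u v _ IH|u v w _ IH1 _ IH2|u u' v v' _ Eu _ Ev] l ln.
- case: uv => [[]|] [-> ->].
  + split=> [|p q _]; first by rewrite count_cat /= addnC.
    (* Crossing [n] letters [b] shifts the level by [n], which is -1 modulo [n.+1]: the [a] gets the
       type of the [c]. *)
    rewrite types_cat /= -[nseq n Lb]cats0 !types_nseqb /end_level.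
    by rewrite cats0 count_nseq mul1n iter_cyc_succ_pred.
  + split=> // p q _; rewrite /= /cyc_pred /cyc_succ.
    by case: (l =P n) => // ->.
  + split=> // p q; rewrite /adjacent /=.
    (* A projection keeping both letters would have [p] and [q] equal to their types [l] and
       [cyc_pred l], which are adjacent. *)
    case: ifP; case: ifP => // /orP[]/eqP E1 /orP[]/eqP E2; rewrite E1 E2 //.
      by rewrite -E1 -E2 cyc_predK ?eqxx ?orbT.
    by rewrite -E1 -E2 cyc_predK ?eqxx ?orbT.
- by split.
- exact/same_traceC/IH.
- exact: same_trace_trans (IH1 l ln) (IH2 l ln).
- exact: same_trace_cat ln (Eu l ln) Ev.
Qed.

Lemma same_trace_catIl l w u v :
  same_trace l (w ++ u) (w ++ v) -> same_trace (end_level l w) u v.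
Proof.
case=> C P; split=> [|p q pq]; first by move: C; rewrite !count_cat => /addnI.
move: (P p q pq); rewrite !types_cat !filter_cat => /eqP.
by rewrite eqseq_cat // eqxx => /eqP.
Qed.

(** Since [u] and [v] contain equally many [b], both copies of [w] start at the same level and have
    the same projections. *)
Lemma same_trace_catIr l w u v :
  same_trace l (u ++ w) (v ++ w) -> same_trace l u v.
Proof.
case=> C P; have Cuv: count is_b u = count is_b v.
  by move: C; rewrite !count_cat => /addIn.
split=> // p q /P; rewrite !types_cat !filter_cat /end_level Cuv => E.
have /(congr1 size) := E; rewrite !size_cat => /addIn sE.
by move/eqP: E; rewrite eqseq_cat // eqxx andbT => /eqP.
Qed.

(** * Pulling a letter to the front inside the monoid *)

Local Notation M := (Gplus n).
Local Notation pi := \pi_M.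

Lemma pi_cat u v : pi (u ++ v) = (pi u * pi v)%g.
Proof. by rewrite -pi_presented_cat. Qed.

Lemma pi_cons x u : pi (x :: u) = (pi [:: x] * pi u)%g.
Proof. by rewrite -pi_cat. Qed.

Lemma pi_nseq k x : pi (nseq k x) = (pi [:: x] ^+ k)%g.
Proof. by elim: k => [//|k IHk]; rewrite expgS -IHk -pi_cat. Qed.

Local Notation a := (pi [:: La]).
Local Notation b := (pi [:: Lb]).
Local Notation c := (pi [:: Lc]).

Lemma mul_ab : (a * b = b * c)%g.
Proof. by rewrite -!pi_cat; apply/pi_presentedP/gen_cong_base; left; right. Qed.

Lemma mul_ac : (a * c = c * a)%g.
Proof. by rewrite -!pi_cat; apply/pi_presentedP/gen_cong_base; right. Qed.

Lemma mul_cbn : (c * b ^+ n = b ^+ n * a)%g.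
Proof.
by rewrite -pi_nseq -!pi_cat; apply/pi_presentedP/gen_cong_base; left; left.
Qed.

Definition cyc_add p s := if p + s <= n then p + s else p + s - n.+1.

Lemma cyc_add_succ p s : p <= n -> s <= n ->
  cyc_succ (cyc_add p s) = cyc_add p (cyc_succ s).
Proof. by rewrite /cyc_succ /cyc_add => *; do !case: ifP; lia. Qed.

(* If a word starts at level [p + s] and its first letter of type [p] is preceded
   only by letters of types [p - 1] and [p + 1], then [pulled s i] divides it on
   the left for some [i].  Only [s = 0, 1] matter in the end, the other values
   being the levels crossed by a [c] on its way through [cb^n = b^na]. *)
Definition pulled s i : M :=
  (match s with
   | 0 => a
   | 1 => c
   | 2 => c ^+ i * b ^+ n.-1 * a
   | _ => b ^+ (n.+1 - s) * a
   end)%g.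

Lemma pulled_gt2 s i : 2 < s -> pulled s i = (b ^+ (n.+1 - s) * a)%g.
Proof. by case: s => [|[|[|s]]]. Qed.

Lemma pull p s v y : 2 < n -> p <= n -> s <= n -> ~~ is_b y ->
    letter_type (end_level (cyc_add p s) v) y = p ->
    all (adjacent p) (types (cyc_add p s) v) ->
  exists i z, (pi (v ++ [:: y]) = pulled s i * z)%g.
Proof.
move=> n_gt2 pn; elim: v s => [|x v IHv] s sn yNb.
  move=> Ey _; exists 0, 1%g; rewrite mulg1 /=.
  move: Ey; rewrite /letter_type /end_level /cyc_add /cyc_pred /=.
  case: y yNb => // _ Ey; first suff -> : s = 0 by [].
    by case: (leqP (p + s) n) Ey; lia.
  suff -> : s = 1 by [].
  by move: Ey; case: (leqP (p + s) n) => ?; case: eqP; lia.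
rewrite end_level_cons cat_cons pi_cons; case: x => /=.
- move=> Ey /andP[adj allv]; have [i [z ->]] := IHv s sn yNb Ey allv.
  (* This [a] has type [p + s], so [s] is 1 or -1 modulo [n.+1]; the second case uses
     [aba = bca = bac]. *)
  have: s = 1 \/ s = n.
    move: adj; rewrite /adjacent /letter_type /cyc_add /cyc_succ /=.
    by case: (leqP (p + s) n) => ?; do !case: eqP; lia.
  case=> ->; first by exists 0, (a * z)%g; rewrite /= !mulgA mul_ac.
  exists 0, (c * z)%g; rewrite !pulled_gt2 // subSnn expg1.
  by rewrite !mulgA mul_ab -(mulgA b c) -mul_ac mulgA.
- rewrite cyc_add_succ // => Ey allv.
  have [i [z ->]] := IHv _ (cyc_succ_le sn) yNb Ey allv.
  rewrite /cyc_succ; case: eqP => [->|sNn].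
    by exists 0, z; rewrite (pulled_gt2 _ n_gt2) subSnn expg1 /= mulgA.
  case: s sn sNn {Ey allv} => [|[|[|s]]] sn sNn.
  + by exists 0, (b * z)%g; rewrite /= !mulgA mul_ab.
  (* Here [b c^i b^(n-1) a = a^i b^n a = a^i c b^n = c a^i b^n]. *)
  + exists 0, (a ^+ i * b ^+ n * z)%g => /=.
    have bci: (b * c ^+ i = a ^+ i * b)%g.
      elim: (i) => [|k IHk]; first by rewrite !expg0 mul1g mulg1.
      by rewrite expgSr mulgA IHk -mulgA -mul_ab mulgA -expgSr.
    have cai: (c * a ^+ i = a ^+ i * c)%g.
      elim: (i) => [|k IHk]; first by rewrite !expg0 mul1g mulg1.
      by rewrite expgSr mulgA IHk -mulgA -mul_ac mulgA -expgSr.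
    rewrite !mulgA bci cai -!(mulgA (a ^+ i)%g) mul_cbn.
    by rewrite -expgS prednK ?(ltn_trans _ n_gt2) // !mulgA.
  + exists 0, z => /=; rewrite expg0 mul1g mulgA mulgA -expgS.
    by congr (_ ^+ _ * _ * _)%g; lia.
  + exists 0, z => /=; rewrite mulgA mulgA -expgS.
    by congr (_ ^+ _ * _ * _)%g; lia.
- move=> Ey /andP[adj allv]; have [i [z ->]] := IHv s sn yNb Ey allv.
  (* This [c] has type [p + s - 1]. At [s = 2] it is stored in the power [c^i], until a [b] on its
     left turns it into an [a]. *)
  have: s = 0 \/ s = 2.
    move: adj; rewrite /adjacent /letter_type /cyc_add /cyc_succ /cyc_pred /=.
    by case: (leqP (p + s) n) => ?; do !case: eqP; lia.
  case=> ->; first by exists 0, (c * z)%g; rewrite /= !mulgA mul_ac.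
  by exists i.+1, z; rewrite /= expgS !mulgA.
Qed.

(** * Injectivity of the invariants *)

Lemma types_split p l v : p \in types l v ->
  exists v1 y v2, [/\ v = v1 ++ y :: v2, ~~ is_b y,
    letter_type (end_level l v1) y = p & p \notin types l v1].
Proof.
elim: v l => [//|x v IHv] l; have [xb|xNb] := boolP (is_b x).
  case: x xb => // _ /=.
  case/IHv=> v1 [y [v2 [-> yNb Ey pNv1]]].
  by exists (Lb :: v1), y, v2; rewrite end_level_cons.
rewrite types_cons // inE; have [-> _|pNx] := eqVneq p; first by exists [::], x, v.
case/IHv=> v1 [y [v2 [-> yNb Ey pNv1]]]; exists (x :: v1), y, v2.
by rewrite end_level_cons types_cons // (negbTE xNb) inE negb_or pNx.
Qed.

Lemma same_trace_pull l x u v : 2 < n -> l <= n -> ~~ is_b x ->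
  same_trace l (x :: u) v -> exists v', v ~~~ x :: v'.
Proof.
move=> n_gt2 ln xNb [_ Puv]; set p := letter_type l x.
have pn : p <= n by apply: letter_type_le.
(* This allows the projection to the single type [p], which shows that [p] occurs in [v]. *)
have pNp : ~~ adjacent p p.
  by rewrite /adjacent /cyc_succ orbb; do !case: eqP; lia.
have /types_split[v1 [y [v2 [Ev yNb Ey pNv1]]]] : p \in types l v.
  have: p \in filter (pred2 p p) (types l v).
    by rewrite -Puv // types_cons //= eqxx inE eqxx.
  by rewrite mem_filter => /andP[].
(* A non-adjacent [q] in [v1] would precede [p] in the projection of [v] to [p] and [q], whereas
   that of [x :: u] starts with [p]. *)
have adj : all (adjacent p) (types l v1).
  apply/allP=> q qv1; apply/negPn/negP=> pNq.
  have := Puv p q pNq; rewrite types_cons //= eqxx Ev types_cat filter_cat.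
  have: {subset filter (pred2 p q) (types l v1) <= [:: q]}.
    move=> r; rewrite mem_filter /= inE => /andP[/orP[/eqP->|//]].
    by rewrite (negbTE pNv1).
  have: q \in filter (pred2 p q) (types l v1) by rewrite mem_filter /= eqxx orbT.
  case: filter => // r s _ /(_ r (mem_head _ _)); rewrite inE => /eqP-> [qp _].
  by move: pNv1; rewrite /p qp qv1.
(* The offset of [l] from [p]; [pulled] at this offset is the letter [x] itself. *)
pose is_c := if x is Lc then 1 else 0.
have [i [z Ez]] : exists i z, (pi (v1 ++ [:: y]) = pulled is_c i * z)%g.
  have El : l = cyc_add p is_c.
    rewrite /p /is_c /cyc_add /letter_type /cyc_pred; case: (x) xNb => //= _.
      by rewrite addn0 ln.
    by do !case: ifP; lia.
  apply: (pull (p := p)); rewrite -?El //.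
  by rewrite /is_c; case: (x); lia.
exists (repr z ++ v2); apply/pi_presentedP.
rewrite Ev -cat1s catA pi_cat Ez -cat1s !pi_cat reprK mulgA.
by rewrite /is_c; case: (x) xNb.
Qed.

(** Induction on length: two leading [b] are cancelled; otherwise a leading [a] or [c] of one word
    is pulled to the front of the other. *)
Lemma same_trace_gen_cong l u v : 2 < n -> l <= n ->
  size u = size v -> same_trace l u v -> u ~~~ v.
Proof.
move=> n_gt2; move Em: (size u) => m.
elim: m l u v Em => [|m IHm] l [|x u] [|y v] //= Em ln Ev Euv.
  exact: gen_cong_refl.
move: Em Ev => [Em] [Ev].
have step z w w' : size w = m -> size w' = m ->
    same_trace l (z :: w) (z :: w') -> z :: w ~~~ z :: w'.
  move=> Ew Ew' tww'; apply: (gen_cong_cat (gen_cong_refl _ [:: z])).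
  apply: IHm (end_level_le [:: z] ln) _ _ => //.
  exact: (same_trace_catIl (w := [:: z])).
have letter_case z w w' : size w = m -> size w' = m.+1 -> ~~ is_b z ->
    same_trace l (z :: w) w' -> z :: w ~~~ w'.
  move=> Ew Ew' zNb tww'; have [w1 cw'] := same_trace_pull n_gt2 ln zNb tww'.
  have Ew1 : size w1 = m by have := gen_cong_size cw'; rewrite Ew' => -[].
  apply: gen_cong_trans (gen_cong_sym cw'); apply: step => //.
  exact: same_trace_trans tww' (gen_cong_same_trace cw' ln).
have [xb|xNb] := boolP (is_b x); last by apply: letter_case Euv; rewrite //= -?Ev.
have [yb|yNb] := boolP (is_b y); last first.
  by apply/gen_cong_sym/letter_case; rewrite //= ?Em //; apply: same_traceC.
by case: x y xb yb Euv => [] // [] // _ _; apply: step.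
Qed.

End Gplus.

Theorem theorem4p1 (n : nat) (hn : 3 <= n) : cancellative (Gplus n).
Proof.
elim/quotW=> A; elim/quotW=> B; elim/quotW=> X; elim/quotW=> Y.
rewrite -(pi_cat n A X) -(pi_cat n A Y) -!pi_cat => /pi_presentedP E.
apply/pi_presentedP.
(* Once the prefix [A] is removed, [X] and [Y] are read from the level where [A] ends. *)
apply: (same_trace_gen_cong (l := end_level n 0 A)) => //.
- exact: end_level_le.
- by have := gen_cong_size E; rewrite !size_cat => /addIn/addnI.
- apply: same_trace_catIl; apply: (same_trace_catIr (w := B)).
  exact: gen_cong_same_trace E _ _.
Qed.
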